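(* Let $R$ be a commutative ring with unity. Consider the graph $G'' = \Gamma(\operatorname{Id}(R), +)$. (1) $\chi(G'') = \operatorname{clique} G'' = |\Omega(R)|$. (2) If $R$ is local (i.e. has only one maximal ideal), then $G''= \emptyset$. (3) Suppose $R$ has exactly two maximal ideals $\mathfrak{m}_1, \mathfrak{m}_2$. If all nonmaximal proper ideals are contained in $\mathfrak{m}_1 \cap \mathfrak{m}_2$, then $\operatorname{diam} G'' = 1$; otherwise $\operatorname{diam} G'' = 2$. Moreover, if there exist $J_1, J_2 \in \operatorname{Id}(R) \setminus \Omega(R)$ such that $J_i \subseteq \mathfrak{m}_i$ for $i=1,2$ but $J_1 \nsubseteq \mathfrak{m}_2$ and $J_2 \nsubseteq \mathfrak{m}_1$, then $\operatorname{girth} G'' = 4$; otherwise $\operatorname{girth} G'' = \infty$. (4) If $|\Omega(R)| \geq 3$, then $\operatorname{girth} G'' = 3$. (5) If $|\Omega(R)| \geq 3$ and $\operatorname{Jac} R$ is prime, then $\operatorname{diam} G'' = 2$. (6) If $|\Omega(R)| \geq 3$ and $\operatorname{Jac} R$ is not prime, then $\operatorname{diam} G'' = 3$.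
   Context: $\Omega(R)$ is the set of maximal ideals of $R$, and $\operatorname{Jac} R$ is the intersection of all maximal ideals of $R$. $\operatorname{Id}(R)$ is the set of all ideals of $R$, regarded as a commutative semigroup under ideal addition; its absorbing element (''zero'') is the unit ideal $R$. $\Gamma(\operatorname{Id}(R),+)$ is the zero-divisor graph of this semigroup: its vertices are the ideals $I\neq R$ such that $I+J=R$ for some ideal $J\neq R$, and two distinct vertices $I,J$ are adjacent precisely when $I+J=R$. For a graph $G$: $\operatorname{diam} G$ is the supremum of the distances between pairs of vertices; $\operatorname{girth} G$ is the length of a shortest cycle, or $\infty$ if there are no cycles; $\operatorname{clique} G$ is the supremum of the cardinalities of sets of vertices on which the induced subgraph is complete; $\chi(G)$ is the infimum of the cardinalities of sets $A$ for which there is a map from the vertices of $G$ to $A$ taking different values on adjacent vertices.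
   Formalization: In (1) the equality with |Ω(R)| is claimed only for R not local, since for local R the graph is empty, so χ(G'') = clique G'' = 0 while |Ω(R)| = 1; χ(G'') = clique G'' is kept for every R. *)

(* Defs.v *)
From HB Require Import structures.
From mathcomp Require Import all_boot all_order all_algebra.
From mathcomp Require Import boolp classical_sets functions cardinality.
From mathcomp Require Import constructive_ereal.

Set Implicit Arguments.
Unset Strict Implicit.
Unset Printing Implicit Defensive.

Import Order.TTheory GRing.Theory Num.Theory.

Local Open Scope classical_set_scope.
Local Open Scope ring_scope.
Local Open Scope card_scope.

(* Possibly infinite simple graphs. *)
Record graph := Graph {
  vertex :> choiceType;
  adj : rel vertex;
  adj_sym : symmetric adj;
  adj_irr : irreflexive adj }.

(* The values of [dist], [diam] and [girth] are 0, 1, 2, ... or +oo; the first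
   argument of [infimum] and [supremum] is their value on the empty set. *)
Definition dist (G : graph) (x y : G) : \bar int :=
  infimum +oo%E [set (size p)%:Z%:E | p in
    [set p : seq G | path (@adj G) x p /\ last x p = y]].

Definition diam (G : graph) : \bar int :=
  supremum 0%E [set dist x y | x in [set: G] & y in [set: G]].

Definition girth (G : graph) : \bar int :=
  infimum +oo%E [set (size c)%:Z%:E | c in
    [set c : seq G | (2 < size c)%N /\ ucycle (@adj G) c]].

Definition is_clique (G : graph) (C : set G) : Prop :=
  forall x y, C x -> C y -> x <> y -> adj x y.

Definition is_coloring (G : graph) (A : Type) (f : G -> A) : Prop :=
  forall x y, adj x y -> f x <> f y.

(* A (possibly infinite) cardinal is represented by any set [K] having it.
   [|K|] is the least upper bound of the cardinals of the cliques of [G]. *)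
Definition is_clique_number (G : graph) (T : Type) (K : set T) : Prop :=
  (forall C : set G, is_clique C -> C #<= K) /\
  (forall (U : Type) (L : set U),
     (forall C : set G, is_clique C -> C #<= L) -> K #<= L).

(* [|K|] is the greatest lower bound of the numbers of colors. *)
Definition is_chromatic_number (G : graph) (T : Type) (K : set T) : Prop :=
  (forall (A : Type) (f : G -> A), is_coloring f -> K #<= [set: A]) /\
  (forall (U : Type) (L : set U),
     (forall (A : Type) (f : G -> A), is_coloring f -> L #<= [set: A]) ->
     L #<= K).

(* The zero-divisor graph of a commutative semigroup [(S, op)] with absorbing
   element [z]. *)
Section ZeroDivisorGraph.
Variables (S : choiceType) (op : SemiGroup.com_law S) (z : S).

Definition nonzero_zero_divisors : set S :=
  [set x | x <> z /\ exists2 y, y <> z & op x y = z].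

Definition zdg_adj : rel nonzero_zero_divisors :=
  fun x y => (x != y) && (op (val x) (val y) == z).

Lemma zdg_adj_sym : symmetric zdg_adj.
Proof. by move=> x y; rewrite /zdg_adj eq_sym SemiGroup.opC. Qed.

Lemma zdg_adj_irr : irreflexive zdg_adj.
Proof. by move=> x; rewrite /zdg_adj eqxx. Qed.

Definition zero_divisor_graph : graph := Graph zdg_adj_sym zdg_adj_irr.

End ZeroDivisorGraph.

(* Ideals are not required to be proper, and the ring may be zero. *)
Record ideal (R : comPzRingType) := Ideal {
  ideal_set :> set R;
  ideal0 : ideal_set 0;
  idealD : forall x y, ideal_set x -> ideal_set y -> ideal_set (x + y);
  idealM : forall a x, ideal_set x -> ideal_set (a * x) }.

HB.instance Definition _ (R : comPzRingType) := gen_eqMixin (ideal R).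
HB.instance Definition _ (R : comPzRingType) := gen_choiceMixin (ideal R).

Section Ideals.
Variable R : comPzRingType.
Implicit Types I J : ideal R.

Lemma ideal_inj I J : (I : set R) = J -> I = J.
Proof.
case: I J => [I I0 ID IM] [J J0 JD JM] /= IJ; subst J.
by congr Ideal; exact: Prop_irrelevance.
Qed.

Definition unit_ideal : ideal R :=
  @Ideal R setT I (fun _ _ _ _ => I) (fun _ _ _ => I).

Definition add_set I J : set R := [set a + b | a in I & b in J].

Lemma add_set0 I J : add_set I J 0.
Proof.
by exists 0; [exact: ideal0|exists 0; [exact: ideal0|exact: addr0]].
Qed.

Lemma add_setD I J x y : add_set I J x -> add_set I J y -> add_set I J (x + y).
Proof.
move=> [a Ia [b Jb <-]] [c Ic [d Jd <-]].
exists (a + c); first exact: idealD.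
by exists (b + d); [exact: idealD|rewrite addrACA].
Qed.

Lemma add_setM I J r x : add_set I J x -> add_set I J (r * x).
Proof.
move=> [a Ia [b Jb <-]]; exists (r * a); first exact: idealM.
by exists (r * b); [exact: idealM|rewrite mulrDr].
Qed.

Definition add_ideal I J : ideal R :=
  Ideal (add_set0 I J) (@add_setD I J) (@add_setM I J).

Lemma add_idealA : associative add_ideal.
Proof.
move=> I J K; apply/ideal_inj/seteqP; split => x /=.
- move=> [a Ia [_ [b Jb [c Kc <-]] <-]].
  by exists (a + b); [exists a => //; exists b|exists c; rewrite ?addrA].
- move=> [_ [a Ia [b Jb <-]] [c Kc <-]].
  by exists a => //; exists (b + c); [exists b => //; exists c|rewrite addrA].
Qed.

Lemma add_idealC : commutative add_ideal.
Proof.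
move=> I J; apply/ideal_inj/seteqP.
by split => x [a Ia [b Jb <-]]; exists b => //; exists a; rewrite 1?addrC.
Qed.

Lemma add_unit_ideal I : add_ideal unit_ideal I = unit_ideal.
Proof.
apply/ideal_inj/seteqP; split => // x _.
by exists x => //; exists 0; [exact: ideal0|exact: addr0].
Qed.

HB.instance Definition _ :=
  SemiGroup.isComLaw.Build (ideal R) add_ideal add_idealA add_idealC.

Definition maximal_ideal I : Prop :=
  I <> unit_ideal /\ forall J, I `<=` J -> J = I \/ J = unit_ideal.

Definition Omega : set (ideal R) := [set I | maximal_ideal I].

Definition prime_ideal I : Prop :=
  I <> unit_ideal /\ forall x y : R,
    ideal_set I (x * y) -> ideal_set I x \/ ideal_set I y.

Definition Jac_set : set R := \bigcap_(m in Omega) (m : set R).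

Lemma Jac_set0 : Jac_set 0.
Proof. by move=> m _; exact: ideal0. Qed.

Lemma Jac_setD x y : Jac_set x -> Jac_set y -> Jac_set (x + y).
Proof. by move=> Jx Jy m Om; apply: idealD; [exact: Jx|exact: Jy]. Qed.

Lemma Jac_setM a x : Jac_set x -> Jac_set (a * x).
Proof. by move=> Jx m Om; apply: idealM; exact: Jx. Qed.

Definition Jac : ideal R := Ideal Jac_set0 Jac_setD Jac_setM.

Definition local_ring : Prop := exists m, Omega = [set m].

Definition ideal_graph : graph := zero_divisor_graph add_ideal unit_ideal.

End Ideals.

Arguments unit_ideal R : clear implicits.
Arguments Omega R : clear implicits.
Arguments Jac R : clear implicits.
Arguments local_ring R : clear implicits.
Arguments ideal_graph R : clear implicits.

(* Main.v *)
Require Import Defs.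
From HB Require Import structures.
From mathcomp Require Import all_boot all_order all_algebra.
From mathcomp Require Import boolp classical_sets functions cardinality.
From mathcomp Require Import constructive_ereal.

Set Implicit Arguments.
Unset Strict Implicit.
Unset Printing Implicit Defensive.

Import Order.TTheory GRing.Theory Num.Theory.

Local Open Scope classical_set_scope.
Local Open Scope ring_scope.
Local Open Scope card_scope.

(** The ideal graph is governed by the sets V(I) of maximal ideals containing
    an ideal I. Since every proper ideal lies in a maximal one (Zorn), I is a
    vertex precisely when V(I) is neither empty nor all of Omega
    ([vertex_of], [vertex_bounds]), and I, J are adjacent precisely when V(I)
    and V(J) are disjoint ([adjP]). Every claim is then about these sets.

    Colors and cliques. The maximal vertices form a clique, and sending a
    vertex I to some maximal ideal in V(I) is a proper coloring by that
    clique. A graph which is so colored by one of its own cliques has that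
    clique as its clique number and its chromatic number
    ([clique_coloring_numbers]).

    Two maximal ideals. Each V(I) is a singleton, so the graph is complete
    bipartite. Its diameter is 1 or 2 according to whether both parts are
    singletons, and its girth is 4 or infinite according to whether both parts
    have at least two elements; each part contains a maximal ideal, so a part
    has a second element exactly when it has a nonmaximal one.

    At least three maximal ideals. Three of them form a triangle. Any vertex I
    is adjacent to every maximal ideal outside V(I), so the distance between
    I and J is at most 3, and at most 2 if some maximal ideal is outside both
    V(I) and V(J). The latter always exists when Jac R is prime, as the
    product of two ideals not contained in Jac R is not contained in Jac R.
    The distance 2 is attained there: if m1, m2, m3 are distinct maximal
    ideals, then m1 and a principal ideal contained in m1 and m2 but not in m3
    are two distinct vertices which are not adjacent.

    When Jac R is not prime, take a, b outside Jac R with a * b in Jac R.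
    Then V(a) and V(b) cover Omega, so that (a) and (b) have no common
    neighbor. If (a) and (b) happen to be adjacent, one of V(a), V(b), say
    V(a), has two elements m1, m2; replacing b by a multiple b * c with c in
    m1 but not in m2 adds m1 to V(b), which makes the two ideals nonadjacent,
    hence at distance 3 ([not_prime_Jac_witness]). *)

(** * Distance, diameter and girth of a graph *)

Lemma infimum_attained (T : Type) (A : set T) (f : T -> nat) (a : T) :
  A a -> (forall c, A c -> (f a <= f c)%N) ->
  infimum +oo%E [set (f c)%:Z%:E | c in A] = (f a)%:Z%:E :> \bar int.
Proof.
move=> Aa fa; set E := image _ _.
have Ea : E (f a)%:Z%:E by exists a.
rewrite /infimum ifF; last by apply/negbTE/set0P; exists (f a)%:Z%:E.
apply: xget_subset1 (@is_subset1_infimums _ _ E); split.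
  by move=> _ [c Ac <-]; rewrite lee_fin lez_nat fa.
by move=> z; apply.
Qed.

Lemma supremum_attained (E : set (\bar int)) (x0 z : \bar int) :
  E z -> (forall x, E x -> (x <= z)%E) -> supremum x0 E = z.
Proof.
move=> Ez ub; rewrite /supremum ifF; last by apply/negbTE/set0P; exists z.
apply: xget_subset1 (@is_subset1_supremums _ _ E).
by split => // y; apply.
Qed.

Section GraphMetric.
Variable G : graph.
Implicit Types (x y : G) (p : seq G).

Lemma dist_attained x y p : path (@adj G) x p -> last x p = y ->
  exists q, [/\ path (@adj G) x q, last x q = y, (size q <= size p)%N
              & dist x y = (size q)%:Z%:E].
Proof.
move=> xp py.
pose P n := `[< exists q, [/\ path (@adj G) x q, last x q = y & size q = n] >].
have exP : exists n, P n by exists (size p); apply/asboolP; exists p.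
case: (ex_minnP exP) => n /asboolP[q [xq qy qn]] nmin; exists q; split => //.
  by rewrite qn; apply: nmin; apply/asboolP; exists p.
apply: infimum_attained => // r [xr ry]; rewrite qn.
by apply: nmin; apply/asboolP; exists r.
Qed.

Definition walk_le n x y : Prop :=
  exists p, [/\ path (@adj G) x p, last x p = y & (size p <= n)%N].

Lemma walk_le_refl n x : walk_le n x x.
Proof. by exists [::]. Qed.

Lemma walk_le_step n x y z : adj x y -> walk_le n y z -> walk_le n.+1 x z.
Proof. by move=> xy [p [yp pz pn]]; exists (y :: p); rewrite /= xy. Qed.

Lemma walk_le1 n x y : adj x y -> walk_le n.+1 x y.
Proof. by move=> xy; apply: walk_le_step xy (walk_le_refl _ _). Qed.

Lemma diam_eq (n : nat) : (forall x y, walk_le n x y) ->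
  (exists x y, forall p,
     path (@adj G) x p -> last x p = y -> (n <= size p)%N) ->
  diam G = n%:Z%:E.
Proof.
move=> ub [x [y lb]]; apply: supremum_attained.
  exists x => //; exists y => //.
  have [p [xp py pn]] := ub x y.
  have [q [xq qy qp ->]] := dist_attained xp py.
  by congr (_%:Z%:E); apply/eqP; rewrite eqn_leq lb// (leq_trans qp).
move=> _ [u _] [v _ <-].
have [p [xp py pn]] := ub u v.
have [q [xq qy qp ->]] := dist_attained xp py.
by rewrite lee_fin lez_nat (leq_trans qp).
Qed.

Lemma girth_eq (c : seq G) : (2 < size c)%N -> ucycle (@adj G) c ->
  (forall d : seq G, (2 < size d)%N -> ucycle (@adj G) d ->
     (size c <= size d)%N) ->
  girth G = (size c)%:Z%:E.
Proof.
by move=> c2 cc cmin; apply: infimum_attained => // d [d2 dd]; exact: cmin.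
Qed.

Lemma girth_acyclic :
  (forall c : seq G, (2 < size c)%N -> ucycle (@adj G) c -> False) ->
  girth G = +oo%E.
Proof.
move=> nc; rewrite /girth [X in infimum _ X](_ : _ = set0) ?/infimum ?eqxx//.
by apply/seteqP; split => // z [c [c2 cc] _]; have := nc _ c2 cc.
Qed.

Lemma girth3 x y z : adj x y -> adj y z -> adj z x -> girth G = 3%:Z%:E.
Proof.
move=> xy yz zx; apply: (@girth_eq [:: x; y; z]) => //.
have adj_neq (u v : G) : adj u v -> (u == v) = false.
  by move=> uv; apply/negP => /eqP e; rewrite e adj_irr in uv.
rewrite /ucycle /= xy yz zx /= !inE.
by rewrite (adj_neq x y)// (adj_neq y z)// eq_sym (adj_neq z x).
Qed.

Lemma walk_ge1 x y p : x <> y -> last x p = y -> (1 <= size p)%N.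
Proof. by case: p. Qed.

Lemma walk_ge2 x y p : x <> y -> ~~ adj x y ->
  path (@adj G) x p -> last x p = y -> (2 <= size p)%N.
Proof.
move=> xy nxy; case: p => [|a [|b p]] //=.
by rewrite andbT => xa ay; rewrite -ay xa in nxy.
Qed.

Lemma walk_ge3 x y p : x <> y -> ~~ adj x y ->
  (forall w, adj x w -> adj w y -> False) ->
  path (@adj G) x p -> last x p = y -> (3 <= size p)%N.
Proof.
move=> xy nxy nw xp py; have := walk_ge2 xy nxy xp py; move: xp py.
case: p => [|a [|b [|c p]]] //=; rewrite andbT => /andP[xa ab] bY _.
by case: (nw a) => //; rewrite -bY.
Qed.

End GraphMetric.

(** * Cliques and colorings *)

Lemma card_le_inj (T U : Type) (A : set T) (B : set U) (f : T -> U) :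
  set_fun A B f -> set_inj A f -> A #<= B.
Proof.
move=> fAB finj; have [g] : $|{injfun A >-> B}| by apply/injfunPex; exists f.
exact: inj_card_le g.
Qed.

Lemma coloring_inj_clique (G : graph) (A : Type) (f : G -> A) (C : set G) :
  is_coloring f -> is_clique C -> set_inj C f.
Proof.
move=> fcol Ccl x y /set_mem Cx /set_mem Cy fxy.
by apply: contrapT => xy; exact: fcol (Ccl _ _ Cx Cy xy) fxy.
Qed.

(** A coloring is injective on cliques. So every clique embeds in [K] through
    [r], and [K] embeds in every set of colors. *)
Lemma clique_coloring_numbers (G : graph) (K : set G) (r : G -> G) :
  is_clique K -> is_coloring r -> (forall x, K (r x)) ->
  is_chromatic_number G K /\ is_clique_number G K.
Proof.
move=> Kcl rcol rK; split; split.
- move=> A f fcol; apply: (@card_le_inj _ _ _ _ f) => //.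
  exact: coloring_inj_clique.
- move=> U L LA; pose f x : K := SigSub (mem_set (rK x)).
  rewrite -(card_le_eqr (card_setT K)); apply: LA (f) _ => x y xy.
  by move=> /(congr1 val); exact: rcol.
- move=> C Ccl; apply: (@card_le_inj _ _ _ _ r) => //.
  exact: coloring_inj_clique.
- by move=> U L; apply.
Qed.

(** * Complete bipartite graphs *)

Section CompleteBipartite.
Variables (G : graph) (side : G -> bool).
Hypothesis adjE : forall x y : G, adj x y = (side x != side y).

Lemma bipartite_diam1 (x y : G) : side x != side y -> injective side ->
  diam G = 1%:Z%:E.
Proof.
move=> sxy sinj; apply: diam_eq.
  move=> u v; have [suv|suv] := eqVneq (side u) (side v).
    by rewrite (sinj _ _ suv); exact: walk_le_refl.
  by apply: walk_le1; rewrite adjE.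
exists x, y => p _; apply: walk_ge1 => xy.
by rewrite xy eqxx in sxy.
Qed.

Lemma bipartite_diam2 (x y x' : G) : side x != side y ->
  x <> x' -> side x = side x' -> diam G = 2%:Z%:E.
Proof.
move=> sxy xx' sxx'; apply: diam_eq; last first.
  by exists x, x' => p; apply: walk_ge2 => //; rewrite adjE sxx' eqxx.
move=> u v; have [suv|suv] := eqVneq (side u) (side v); last first.
  by apply: walk_le1; rewrite adjE.
have [w suw] : exists w, side u != side w.
  have [sux|] := eqVneq (side u) (side x); last by exists x.
  by exists y; rewrite sux.
by apply: (walk_le_step (y := w)); rewrite ?adjE//; apply: walk_le1;
  rewrite adjE -suv eq_sym.
Qed.

Lemma bipartite_girth4 (x x' y y' : G) : side x != side y ->
  x <> x' -> side x = side x' -> y <> y' -> side y = side y' ->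
  girth G = 4%:Z%:E.
Proof.
move=> sxy xx' sx yy' sy.
have neq (u v : G) : side u != side v -> (u == v) = false.
  by move=> suv; apply/negP => /eqP e; rewrite e eqxx in suv.
apply: (@girth_eq _ [:: x; y; x'; y']) => //.
  rewrite /ucycle /= !adjE -sx -sy [side y == _]eq_sym sxy /= !inE.
  have /eqP/negbTE-> := xx'; have /eqP/negbTE-> := yy'.
  rewrite (neq x y)// (neq x y') -?sy// (neq x' y') -?sx -?sy//.
  by rewrite (neq y x') -?sx// eq_sym.
case=> [|a [|b [|c [|d e]]]] //= _; rewrite /ucycle /= !adjE.
by case: (side a) (side b) (side c) => [] [] [].
Qed.

(** Every edge has an end in the part with a single element, while a cycle of
    length at least 3 has edges with no common end. *)
Lemma bipartite_girth_star (s : bool) :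
  (forall x y, side x = s -> side y = s -> x = y) -> girth G = +oo%E.
Proof.
move=> star; apply: girth_acyclic.
case=> [|a [|b [|c l]]] //= _; rewrite /ucycle /= !inE !negb_or !adjE.
case: (eqVneq (side a) s) => [sa|sa].
  move=> /andP[/and3P[ab bc _]] /andP[/andP[_ /andP[/eqP ac _]] _].
  apply: ac; apply: star => //; rewrite -sa; move: ab bc.
  by case: (side a) (side b) (side c) => [] [] [].
case: l => [|d l] /=.
  rewrite adjE; move: sa.
  by case: s {star} (side a) (side b) (side c) => [] [] [] [].
rewrite !inE !negb_or !adjE => /andP[/and4P[ab bc cd _]].
move=> /and3P[_ /and3P[_ /eqP bd _] _].
apply: bd; apply: star; move: sa ab bc cd;
  by case: (side a) (side b) (side c) (side d) s => [] [] [] [] [].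
Qed.

End CompleteBipartite.

(** * Maximal ideals *)

Section MaximalIdeals.
Variable R : comPzRingType.
Implicit Types (I J m n : ideal R) (a b x y : R).

Lemma ideal1P I : I = unit_ideal R <-> ideal_set I 1.
Proof.
split=> [->//|I1]; apply/ideal_inj/seteqP; split => // x _.
by rewrite -[x]mulr1; exact: idealM.
Qed.

Lemma maximal_proper m : Omega R m -> ~ ideal_set m 1.
Proof. by move=> [m1 _] /ideal1P. Qed.

Lemma sub_add_ideall I J : I `<=` add_ideal I J.
Proof.
by move=> x Ix; exists x => //; exists 0; [exact: ideal0|rewrite addr0].
Qed.

Lemma sub_add_idealr I J : J `<=` add_ideal I J.
Proof. by move=> x Jx; exists 0; [exact: ideal0|exists x; rewrite ?add0r]. Qed.

Definition principal_set a : set R := [set r * a | r in setT].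

Lemma principal_set0 a : principal_set a 0.
Proof. by exists 0; rewrite ?mul0r. Qed.

Lemma principal_setD a x y :
  principal_set a x -> principal_set a y -> principal_set a (x + y).
Proof. by move=> [r _ <-] [s _ <-]; exists (r + s); rewrite ?mulrDl. Qed.

Lemma principal_setM a b x : principal_set a x -> principal_set a (b * x).
Proof. by move=> [r _ <-]; exists (b * r); rewrite ?mulrA. Qed.

Definition principal a : ideal R :=
  Ideal (principal_set0 a) (@principal_setD a) (@principal_setM a).

Lemma principal_sub a I : principal a `<=` I <-> ideal_set I a.
Proof.
split=> [aI|Ia _ [r _ <-]]; last exact: idealM.
by apply: aI; exists 1; rewrite ?mul1r.
Qed.

Lemma maximal_comaximal m I : Omega R m -> ~ I `<=` m ->
  add_ideal m I = unit_ideal R.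
Proof.
move=> [_ /(_ (add_ideal m I) (@sub_add_ideall m I))[e|//]] Im.
by case: Im; rewrite -e; exact: sub_add_idealr.
Qed.

Lemma maximal_prime m x y : Omega R m ->
  ideal_set m (x * y) -> ideal_set m x \/ ideal_set m y.
Proof.
move=> mmax mxy; have [mx|mx] := pselect (ideal_set m x); [by left|right].
have /ideal1P[u mu [_ [r _ <-] ur1]] : add_ideal m (principal x) = unit_ideal R.
  by apply: maximal_comaximal => // /principal_sub.
rewrite -[y]mul1r -ur1 mulrDl -mulrA; apply: idealD; last exact: idealM.
by rewrite mulrC; exact: idealM.
Qed.

Lemma maximal_sub_eq m n : Omega R m -> Omega R n -> m `<=` n -> m = n.
Proof. by move=> [_ mmax] [n1 _] /mmax[->|]. Qed.

Lemma maximal_separation m n : Omega R m -> Omega R n -> m <> n ->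
  exists2 c, ideal_set m c & ~ ideal_set n c.
Proof.
move=> mmax nmax mn; apply: contrapT => nex; apply/mn/maximal_sub_eq => // c mc.
by apply: contrapT => nc; apply: nex; exists c.
Qed.

(** Zorn's lemma is applied to the sets [A] whose union with [I] is a proper
    ideal, rather than to the proper ideals containing [I]: the union of the
    empty chain then also qualifies. *)
Lemma proper_sub_maximal I : ~ ideal_set I 1 -> exists2 m, Omega R m & I `<=` m.
Proof.
move=> I1.
pose P (A : set R) := exists2 J, ~ ideal_set J 1 & (J : set R) = A `|` I.
have [F FP Ftot|A [[J J1 JE] Amax]] := @Zorn_bigcup R P.
  pose U := \bigcup_(X in F) X `|` I.
  have closed X x : F X -> (X `|` I) x -> U x.
    by move=> FX [Xx|Ix]; [left; exists X|right].
  have UM a x : U x -> U (a * x).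
    move=> [[X FX Xx]|Ix]; last by right; exact: idealM.
    have [J _ JE] := FP _ FX.
    by apply: (closed X) => //; rewrite -JE; apply: idealM; rewrite JE; left.
  have UDX X x y : F X -> (X `|` I) x -> (X `|` I) y -> U (x + y).
    move=> FX; have [J _ JE] := FP _ FX; rewrite -JE => Jx Jy.
    by apply: (closed X) => //; rewrite -JE; exact: idealD.
  have UD x y : U x -> U y -> U (x + y).
    move=> [[X FX Xx]|Ix] [[Y FY Yy]|Iy].
    - have [XY|YX] := Ftot X Y FX FY.
        by apply: (UDX Y) => //; left => //; exact: XY.
      by apply: (UDX X) => //; left => //; exact: YX.
    - by apply: (UDX X) => //; [left|right].
    - by apply: (UDX Y) => //; [right|left].
    - by right; exact: idealD.
  exists (Ideal (or_intror (ideal0 I) : U 0) UD UM) => //= -[[X FX X1]|//].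
  by have [J + JE] := FP _ FX; apply; rewrite JE; left.
exists J; last by rewrite JE; exact: subsetUr.
split=> [/ideal1P//|J' JJ'].
have [/ideal1P->|J'1] := pselect (ideal_set J' 1); [by right|left].
have AJ' : A `<=` J' by apply: subset_trans JJ'; rewrite JE; exact: subsetUl.
have IJ' : I `<=` J' by apply: subset_trans JJ'; rewrite JE; exact: subsetUr.
have PJ' : P J' by exists J' => //; apply/esym/setUidPl.
apply/ideal_inj/seteqP; split => //; rewrite JE.
apply: subset_trans (@subsetUl _ _ _).
by apply: contrapT => J'A; apply: Amax PJ'; split.
Qed.

Lemma comaximalP I J :
  add_ideal I J = unit_ideal R <->
  (forall m, Omega R m -> I `<=` m -> J `<=` m -> False).
Proof.
split=> [/ideal1P[a Ia [b Jb ab1]] m mmax Im Jm|IJ].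
  apply: (maximal_proper mmax); rewrite -ab1.
  by apply: idealD; [exact: Im|exact: Jm].
apply/ideal1P; apply: contrapT => /proper_sub_maximal[m mmax IJm].
apply: (IJ m) => //; apply: subset_trans IJm.
  exact: sub_add_ideall.
exact: sub_add_idealr.
Qed.

Lemma notin_Jac x : ~ Jac_set x <-> exists2 m, Omega R m & ~ ideal_set m x.
Proof.
split=> [Jx|[m mmax mx] /(_ m mmax)//].
apply: contrapT => nex; apply: Jx => m mmax; apply: contrapT => mx.
by apply: nex; exists m.
Qed.

Lemma three_maximal : `I_3 #<= Omega R -> exists m1 m2 m3,
  [/\ Omega R m1, Omega R m2 & Omega R m3] /\
  [/\ m1 <> m2, m1 <> m3 & m2 <> m3].
Proof.
move=> /card_leP[f].
pose i k (k3 : (k < 3)%N) : `I_3 := SigSub (mem_set (k3 : `I_3 k)).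
have fi k l (k3 : (k < 3)%N) (l3 : (l < 3)%N) :
    val (f (i k k3)) = val (f (i l l3)) -> k = l.
  by move=> /val_inj /(inj (in_setT _) (in_setT _)) /(congr1 val).
exists (val (f (i 0%N isT))), (val (f (i 1%N isT))), (val (f (i 2%N isT))).
split; split; try by apply: set_mem; exact: valP.
all: by move=> /fi.
Qed.

(** * The ideal graph *)

Let G := ideal_graph R.
Implicit Types u v w : G.

(** Distinctness of [u] and [v] follows from the right-hand side, because the
    proper ideal [u] lies in some maximal ideal. *)
Lemma adjP u v : adj u v <->
  (forall m, Omega R m -> val u `<=` m -> val v `<=` m -> False).
Proof.
rewrite -comaximalP; split=> [/andP[_ /eqP]//|uv].
apply/andP; split; last exact/eqP.
apply/negP => /eqP e; have [u1 _] := set_mem (valP u).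
have [m mmax um] : exists2 m, Omega R m & val u `<=` m.
  by apply: proper_sub_maximal => /ideal1P.
by move/comaximalP: uv => /(_ m mmax um); rewrite -e.
Qed.

Lemma nonadj u v m : Omega R m -> val u `<=` m -> val v `<=` m -> ~~ adj u v.
Proof. by move=> mmax um vm; apply/negP => /adjP/(_ m mmax um vm). Qed.

Lemma vertex_of I m n : Omega R m -> Omega R n -> I `<=` m -> ~ I `<=` n ->
  exists v : G, val v = I.
Proof.
move=> mmax nmax Im In.
have NI : nonzero_zero_divisors (@add_ideal R) (unit_ideal R) I.
  split=> [I1|]; first by apply: (maximal_proper mmax); apply: Im; rewrite I1.
  exists n; first by case: nmax.
  by rewrite [LHS]add_idealC; exact: maximal_comaximal.
by exists (SigSub (mem_set NI)).
Qed.

Lemma vertex_bounds v : exists m n,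
  [/\ Omega R m, Omega R n, val v `<=` m & ~ val v `<=` n].
Proof.
have [v1 [J J1 /comaximalP vJ]] := set_mem (valP v).
have [m mmax vm] : exists2 m, Omega R m & val v `<=` m.
  by apply: proper_sub_maximal => /ideal1P.
have [n nmax Jn] : exists2 n, Omega R n & J `<=` n.
  by apply: proper_sub_maximal => /ideal1P.
by exists m, n; split => // vn; exact: vJ vn Jn.
Qed.

Lemma maximal_vertex m n : Omega R m -> Omega R n -> m <> n ->
  exists v : G, val v = m.
Proof.
move=> mmax nmax mn; apply: (@vertex_of m m n) => // mn'.
exact/mn/maximal_sub_eq.
Qed.

Lemma maximal_neighbor u m : Omega R m -> ~ val u `<=` m ->
  exists2 w : G, val w = m & adj u w.
Proof.
move=> mmax um; have [n [_ [nmax _ un _]]] := vertex_bounds u.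
have [w wm] : exists w : G, val w = m.
  by apply: (maximal_vertex mmax nmax) => mn; apply: um; rewrite mn.
exists w => //; apply/adjP => k kmax uk; rewrite wm => mk.
by apply: um; rewrite (maximal_sub_eq mmax kmax mk).
Qed.

Lemma maximal_adj u v : Omega R (val u) -> Omega R (val v) -> u <> v ->
  adj u v.
Proof.
move=> umax vmax uv; apply/adjP => m mmax um vm; apply: uv; apply: val_inj.
by rewrite (maximal_sub_eq umax mmax um) (maximal_sub_eq vmax mmax vm).
Qed.

(** The cardinal is represented by the set of maximal vertices: it is empty
    when [R] is local, and otherwise it is a copy of [Omega R]. *)
Lemma chi_clique_Omega : exists (T : Type) (K : set T),
  [/\ is_chromatic_number G K, is_clique_number G K
    & ~ local_ring R -> K #= Omega R].
Proof.
pose K : set G := [set v | Omega R (val v)].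
have /choice[r rP] v : exists w : G, Omega R (val w) /\ val v `<=` val w.
  have [m [n [mmax nmax vm vn]]] := vertex_bounds v.
  have [|w wm] := maximal_vertex mmax nmax; last by exists w; rewrite wm.
  by move=> mn; apply: vn; rewrite -mn.
have [|||chiK cliqueK] := @clique_coloring_numbers G K r.
- by move=> u v Ku Kv; exact: maximal_adj.
- move=> u v /adjP uv ruv; have [rmax ur] := rP u.
  by apply: (uv _ rmax ur); rewrite ruv; case: (rP v).
- by move=> v; case: (rP v).
exists G, K; split => // nloc.
(* a maximal ideal is a vertex as soon as there is a second one *)
have -> : Omega R = val @` K.
  apply/seteqP; split => [m mmax|_ [v Kv <-]//].
  have [n [nmax mn]] : exists n, Omega R n /\ m <> n.
    apply: contrapT => nex; apply: nloc; exists m.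
    apply/seteqP; split => [n nmax /=|n -> //].
    by apply: contrapT => nm; apply: nex; exists n; split => // /esym.
  by have [v vm] := maximal_vertex mmax nmax mn; exists v; rewrite //= /K/= vm.
rewrite card_eq_sym; apply: inj_card_eq => u v _ _; exact: val_inj.
Qed.

Lemma local_graph_empty : local_ring R -> [set: G] = set0.
Proof.
move=> [m mE]; apply/seteqP; split => // v _.
have [k [n [+ + vk vn]]] := vertex_bounds v.
by rewrite mE => /= kE nE; apply: vn; rewrite nE -kE.
Qed.

(** * Two maximal ideals *)

Section TwoMaximalIdeals.
Variables m1 m2 : ideal R.
Hypotheses (m12 : m1 <> m2) (OmegaE : Omega R = [set m1; m2]).

Let max1 : Omega R m1. Proof. by rewrite OmegaE; left. Qed.
Let max2 : Omega R m2. Proof. by rewrite OmegaE; right. Qed.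

Let side v : bool := `[< val v `<=` m1 >].

Lemma sideP v : [/\ side v, val v `<=` m1 & ~ val v `<=` m2] \/
                [/\ ~~ side v, val v `<=` m2 & ~ val v `<=` m1].
Proof.
have [k [n []]] := vertex_bounds v; rewrite OmegaE => -[]-> []-> // vk vn.
  by left; split => //; exact/asboolP.
by right; split => //; exact/asboolPn.
Qed.

Lemma adj_side u v : adj u v = (side u != side v).
Proof.
apply/idP/idP => [/adjP uv|suv].
  case: (sideP u) => -[su ul ur]; case: (sideP v) => -[sv vl vr].
  - by case: (uv _ max1).
  - by rewrite su (negbTE sv).
  - by rewrite sv (negbTE su).
  - by case: (uv _ max2).
apply/adjP => m; rewrite OmegaE => mE um vm; move: suv mE um vm.
case: (sideP u) => -[su ul ur]; case: (sideP v) => -[sv vl vr].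
- by rewrite su sv.
- by move=> _ [->|->].
- by move=> _ [->|->].
- by rewrite (negbTE su) (negbTE sv).
Qed.

Lemma maximal_side u v : Omega R (val u) -> Omega R (val v) ->
  side u = side v -> u = v.
Proof.
move=> umax vmax suv; apply: contrapT => uv.
by have := maximal_adj umax vmax uv; rewrite adj_side suv eqxx.
Qed.

Let vertex1 : exists v : G, val v = m1. Proof. exact: maximal_vertex m12. Qed.
Let vertex2 : exists v : G, val v = m2.
Proof. by apply: (maximal_vertex max2 max1) => /esym. Qed.

Let side1 v : val v = m1 -> side v.
Proof. by move=> vE; apply/asboolP; rewrite vE. Qed.

Let side2 v : val v = m2 -> side v = false.
Proof.
move=> vE; apply/asboolPn; rewrite vE => m21.
by apply: m12; rewrite (maximal_sub_eq max2 max1 m21).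
Qed.

Lemma two_maximal_diam :
  diam G = (if `[< forall I : ideal R, I <> unit_ideal R -> ~ Omega R I ->
                     I `<=` m1 `&` m2 >]
            then 1%:Z%:E else 2%:Z%:E).
Proof.
have [v1 v1E] := vertex1; have [v2 v2E] := vertex2.
have s12 : side v1 != side v2 by rewrite (side1 v1E) (side2 v2E).
case: asboolP => [allJ|nallJ].
  apply: (bipartite_diam1 adj_side s12) => u v.
  have vmax w : Omega R (val w).
    apply: contrapT => wmax.
    have [w1 _] := set_mem (valP w).
    have := allJ _ w1 wmax.
    by case: (sideP w) => -[_ _ nw] wJ; apply: nw => x /wJ[].
  exact: maximal_side.
have [I [I1 Imax Inot]] : exists I : ideal R,
    [/\ I <> unit_ideal R, ~ Omega R I & ~ I `<=` m1 `&` m2].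
  apply: contrapT => nex; apply: nallJ => I I1 Imax.
  by apply: contrapT => Inot; apply: nex; exists I.
have [v vI] : exists v : G, val v = I.
  have [m + Im] : exists2 m, Omega R m & I `<=` m.
    by apply: proper_sub_maximal => /ideal1P.
  rewrite OmegaE => -[]mE; rewrite mE in Im.
    apply: (@vertex_of I m1 m2) => // I2.
    by apply: Inot => x Ix; split; [exact: Im|exact: I2].
  apply: (@vertex_of I m2 m1) => // I1'.
  by apply: Inot => x Ix; split; [exact: I1'|exact: Im].
have neq w : Omega R (val w) -> w <> v.
  by move=> wmax wv; apply: Imax; rewrite -vI -wv.
have [sv|sv] := boolP (side v).
  apply: (@bipartite_diam2 _ side adj_side v1 v2 v) => //.
    by apply: neq; rewrite v1E.
  by rewrite sv side1.
apply: (@bipartite_diam2 _ side adj_side v2 v1 v) => //.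
- by rewrite eq_sym.
- by apply: neq; rewrite v2E.
- by rewrite (negbTE sv) side2.
Qed.

Lemma two_maximal_girth :
  girth G = (if `[< exists J1 J2 : ideal R,
                 [/\ ~ Omega R J1, ~ Omega R J2,
                     J1 `<=` m1 /\ J2 `<=` m2,
                     ~ (J1 `<=` m2) & ~ (J2 `<=` m1)] >]
             then 4%:Z%:E else +oo%E).
Proof.
have [v1 v1E] := vertex1; have [v2 v2E] := vertex2.
have s12 : side v1 != side v2 by rewrite (side1 v1E) (side2 v2E).
case: asboolP => [[J1 [J2 [J1max J2max [J11 J22] J12 J21]]]|nJ].
  have [u1 u1E] := vertex_of max1 max2 J11 J12.
  have [u2 u2E] := vertex_of max2 max1 J22 J21.
  apply: (bipartite_girth4 adj_side s12 (x' := u1) (y' := u2)).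
  - by move=> e; apply: J1max; rewrite -u1E -e v1E.
  - by rewrite side1//; apply/esym/asboolP; rewrite u1E.
  - by move=> e; apply: J2max; rewrite -u2E -e v2E.
  - by rewrite side2//; apply/esym/asboolPn; rewrite u2E.
have [all1|nall1] := pselect (forall u, side u -> Omega R (val u)).
  apply: (bipartite_girth_star adj_side (s := true)) => u v su sv.
  by apply: maximal_side; rewrite ?su ?sv//; apply: all1.
apply: (bipartite_girth_star adj_side (s := false)) => u v su sv.
have all2 w : side w = false -> Omega R (val w).
  move=> sw; apply: contrapT => wmax; apply: nall1 => t st.
  apply: contrapT => tmax; apply: nJ; exists (val t), (val w).
  case: (sideP w) (sideP t) => -[]; rewrite sw // => _ w2 w1.
  by case=> -[]; rewrite st // => _ t1 t2; split.
by apply: maximal_side; rewrite ?su ?sv//; apply: all2.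
Qed.

End TwoMaximalIdeals.

(** * At least three maximal ideals *)

Lemma three_maximal_girth : `I_3 #<= Omega R -> girth G = 3%:Z%:E.
Proof.
move=> /three_maximal[m1 [m2 [m3 [[max1 max2 max3] [m12 m13 m23]]]]].
have [v1 v1E] := maximal_vertex max1 max2 m12.
have [v2 v2E] := maximal_vertex max2 max3 m23.
have [|v3 v3E] := @maximal_vertex m3 m1 max3 max1; first by move/esym.
apply: (@girth3 _ v1 v2 v3); apply: maximal_adj;
  rewrite ?v1E ?v2E ?v3E// => /(congr1 val); rewrite ?v1E ?v2E ?v3E//.
by move/esym.
Qed.

(** The walk goes through [m]. *)
Lemma walk_le2 u v m : Omega R m -> ~ val u `<=` m -> ~ val v `<=` m ->
  walk_le 2 u v.
Proof.
move=> mmax um vm; have [w wm uw] := maximal_neighbor mmax um.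
have [w' w'm vw'] := maximal_neighbor mmax vm.
apply: walk_le_step uw _; apply: walk_le1.
by rewrite adj_sym (_ : w = w')//; apply: val_inj; rewrite wm.
Qed.

Lemma walk_le3 u v : walk_le 3 u v.
Proof.
have [_ [m [_ mmax _ um]]] := vertex_bounds u.
have [_ [n [_ nmax _ vn]]] := vertex_bounds v.
have [w wm uw] := maximal_neighbor mmax um.
have [w' w'n vw'] := maximal_neighbor nmax vn.
have [ww'|ww'] := pselect (w = w').
  by apply: walk_le_step uw _; apply: walk_le1; rewrite ww' adj_sym.
apply: walk_le_step uw _; apply: (walk_le_step (y := w')).
  by apply: maximal_adj; rewrite ?wm ?w'n.
by apply: walk_le1; rewrite adj_sym.
Qed.

Lemma prime_Jac_diam : `I_3 #<= Omega R -> prime_ideal (Jac R) ->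
  diam G = 2%:Z%:E.
Proof.
move=> /three_maximal[m1 [m2 [m3 [[max1 max2 max3] [m12 m13 m23]]]]].
move=> [_ Jprime]; apply: (@diam_eq G) => [u v|].
  have notJac w : exists2 a, ideal_set (val w) a & ~ Jac_set a.
    have [_ [m [_ mmax _ wm]]] := vertex_bounds w.
    apply: contrapT => nex; apply: wm => a wa; apply: contrapT => ma.
    by apply: nex; exists a => // /(_ m mmax).
  have [a ua Ja] := notJac u; have [b vb Jb] := notJac v.
  have /notin_Jac[m mmax mab] : ~ Jac_set (a * b) by move=> /Jprime[].
  apply: (walk_le2 mmax) => [um|vm]; apply: mab; last exact/idealM/vm.
  by rewrite mulrC; exact/idealM/um.
have [a m1a m2a] := maximal_separation max1 max2 m12.
have [b m1b m3b] := maximal_separation max1 max3 m13.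
have [c m2c m3c] := maximal_separation max2 max3 m23.
have [v1 v1E] := maximal_vertex max1 max2 m12.
(* (b * c) is contained in m1 and m2, but not in m3, so that it is a vertex
   which is not adjacent to m1 *)
have bc1 : principal (b * c) `<=` m1.
  by apply/principal_sub; rewrite mulrC; exact: idealM.
have [v vE] : exists v : G, val v = principal (b * c).
  apply: (vertex_of max1 max3 bc1) => /principal_sub.
  by case/(maximal_prime max3).
exists v1, v => p; apply: walk_ge2; last first.
  by apply: (nonadj max1); rewrite ?v1E ?vE.
move=> v1v; apply: m2a; have m1a' := m1a.
rewrite -v1E v1v vE in m1a'.
by apply/(_ : principal (b * c) `<=` m2); [apply/principal_sub; exact: idealM|].
Qed.

(** The maximal ideal [m] containing both [a] and [b] is what prevents the
    ideals [(a)] and [(b)] from being adjacent. To obtain it, note that each of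
    three maximal ideals contains one of the two factors, so that two of them
    contain the same factor. *)
Lemma not_prime_Jac_witness : `I_3 #<= Omega R -> ~ prime_ideal (Jac R) ->
  exists a b m, [/\ Jac_set (a * b), ~ Jac_set a, ~ Jac_set b
                  & [/\ Omega R m, ideal_set m a & ideal_set m b]].
Proof.
move=> /three_maximal[m1 [m2 [m3 [[max1 max2 max3] [m12 m13 m23]]]]] nprime.
(* if b is outside n, multiplying it by c puts it in m and keeps it outside
   n, hence outside the Jacobson radical *)
have two a b m n : Jac_set (a * b) -> ~ Jac_set a -> ~ Jac_set b ->
    [/\ Omega R m, Omega R n & m <> n] ->
    ideal_set m a -> ideal_set n a ->
    exists a b m, [/\ Jac_set (a * b), ~ Jac_set a, ~ Jac_set b
                    & [/\ Omega R m, ideal_set m a & ideal_set m b]].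
  move=> Jab Ja Jb [mmax nmax mn] ma na.
  have [nb|nb] := pselect (ideal_set n b); first by exists a, b, n.
  have [c mc nc] := maximal_separation mmax nmax mn.
  exists a, (b * c), m; split => //.
  - by rewrite mulrA mulrC; exact: Jac_setM.
  - by apply/notin_Jac; exists n => // /(maximal_prime nmax)[].
  - by split => //; exact: idealM.
have [a [b [Jab Ja Jb]]] :
    exists a b, [/\ Jac_set (a * b), ~ Jac_set a & ~ Jac_set b].
  apply: contrapT => nex; apply: nprime; split.
    by move=> /ideal1P/(_ m1 max1); exact: maximal_proper.
  move=> a b Jab; apply: contrapT => /not_orP[Ja Jb].
  by apply: nex; exists a, b.
have Jba : Jac_set (b * a) by rewrite mulrC.
have cover m : Omega R m -> ideal_set m a \/ ideal_set m b.
  by move=> mmax; apply: maximal_prime => //; exact: Jab.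
case: (cover _ max1) (cover _ max2) (cover _ max3) => [a1|b1] [a2|b2] [a3|b3].
- exact: (two a b m1 m2).
- exact: (two a b m1 m2).
- exact: (two a b m1 m3).
- exact: (two b a m2 m3).
- exact: (two a b m2 m3).
- exact: (two b a m1 m3).
- exact: (two b a m1 m2).
- exact: (two b a m1 m2).
Qed.

Lemma not_prime_Jac_diam : `I_3 #<= Omega R -> ~ prime_ideal (Jac R) ->
  diam G = 3%:Z%:E.
Proof.
move=> R3 nprime; apply: (@diam_eq G) => [u v|]; first exact: walk_le3.
have [a [b [m [Jab Ja Jb [mmax ma mb]]]]] := not_prime_Jac_witness R3 nprime.
have cover n : Omega R n -> ideal_set n a \/ ideal_set n b.
  by move=> nmax; apply: maximal_prime => //; exact: Jab.
have vertex_principal x : ~ Jac_set x -> ideal_set m x ->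
    exists v : G, val v = principal x.
  move=> /notin_Jac[n nmax nx] mx.
  by apply: (vertex_of mmax nmax); rewrite principal_sub.
have [u uE] := vertex_principal a Ja ma.
have [v vE] := vertex_principal b Jb mb.
exists u, v => p; apply: walk_ge3.
- move=> uv; apply: Ja => n nmax; case: (cover n nmax) => // nb.
  by apply/principal_sub; rewrite -uE uv vE; exact/principal_sub.
- by apply: (nonadj mmax); rewrite ?uE ?vE; exact/principal_sub.
- move=> w uw wv; have [n [_ [nmax _ wn _]]] := vertex_bounds w.
  case: (cover n nmax) => [na|nb].
    by move/adjP: uw; apply; [exact: nmax|rewrite uE; exact/principal_sub|].
  by move/adjP: wv; apply; [exact: nmax| |rewrite vE; exact/principal_sub].
Qed.

End MaximalIdeals.

Theorem theorem9p1 (R : comPzRingType) :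
  let G := ideal_graph R in
  (exists (T : Type) (K : set T),
     [/\ is_chromatic_number G K,
         is_clique_number G K
       & ~ local_ring R -> K #= Omega R]) /\
  (local_ring R -> [set: G] = set0) /\
  (forall m1 m2 : ideal R, m1 <> m2 -> Omega R = [set m1; m2] ->
     diam G =
       (if `[< forall I : ideal R, I <> unit_ideal R -> ~ Omega R I ->
                 I `<=` m1 `&` m2 >]
        then 1%:Z%:E else 2%:Z%:E) /\
     girth G =
       (if `[< exists J1 J2 : ideal R,
                 [/\ ~ Omega R J1, ~ Omega R J2,
                     J1 `<=` m1 /\ J2 `<=` m2,
                     ~ (J1 `<=` m2) & ~ (J2 `<=` m1)] >]
        then 4%:Z%:E else +oo%E)) /\
  (`I_3 #<= Omega R -> girth G = 3%:Z%:E) /\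
  (`I_3 #<= Omega R -> prime_ideal (Jac R) -> diam G = 2%:Z%:E) /\
  (`I_3 #<= Omega R -> ~ prime_ideal (Jac R) -> diam G = 3%:Z%:E).
Proof.
split; first exact: chi_clique_Omega.
split; first exact: local_graph_empty.
split=> [m1 m2 m12 OmegaE|].
  by split; [exact: two_maximal_diam|exact: two_maximal_girth].
split; first exact: three_maximal_girth.
split; first exact: prime_Jac_diam.
exact: not_prime_Jac_diam.
Qed.
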